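(* Let $R$ be a commutative ring with identity and $M$ a finitely generated $R$-module. If every maximal submodule of $M$ is coprimely structured, then $M$ is coprimely structured.
   Context: All modules are unital. A prime submodule of an $R$-module $M$ is a proper submodule $P$ such that $rm\in P$ with $r\in R$, $m\in M$ implies $m\in P$ or $rM\subseteq P$; every maximal submodule is prime. A prime submodule $P$ of $M$ is called coprimely structured if for every family $\{N_i\}_{i\in I}$ of submodules of $M$ with $N_i+P=M$ for all $i\in I$, one has $\bigcap_{i\in I}N_i\not\subseteq P$. An $R$-module is called coprimely structured if each of its prime submodules is coprimely structured. *)

(* Defs.v *)
From mathcomp Require Import all_boot all_algebra.
From mathcomp Require Import boolp classical_sets.

Set Implicit Arguments.
Unset Strict Implicit.
Unset Printing Implicit Defensive.

Import GRing.Theory.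
Local Open Scope ring_scope.
Local Open Scope classical_set_scope.

(* Submodules are arbitrary [set]s (Prop-valued predicates); [mem] classically
   turns such a set into the boolean predicate [submod_closed] expects. *)
Definition submodule (R : comPzRingType) (M : lmodType R) (N : set M) : Prop :=
  submod_closed (mem N).

Definition finitely_generated (R : comPzRingType) (M : lmodType R) : Prop :=
  exists (n : nat) (g : 'I_n -> M),
    forall x : M, exists c : 'I_n -> R, x = \sum_(i < n) c i *: g i.

Definition maximal_submodule (R : comPzRingType) (M : lmodType R)
    (P : set M) : Prop :=
  [/\ submodule P, P <> setT &
      forall N : set M, submodule N -> P `<=` N -> N = P \/ N = setT].

Definition prime_submodule (R : comPzRingType) (M : lmodType R)
    (P : set M) : Prop :=
  [/\ submodule P, P <> setT &
      forall (r : R) (m : M), P (r *: m) -> P m \/ (forall x : M, P (r *: x))].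

(* Meant for a prime [P]; primality is not a conjunct here, it is a premise in
   [coprimely_structured_module] and automatic for maximal submodules
   ([maximal_submodule_prime]). *)
Definition coprimely_structured (R : comPzRingType) (M : lmodType R)
    (P : set M) : Prop :=
  forall (I : Type) (N : I -> set M),
    (forall i, submodule (N i)) ->
    (forall i, [set x + y | x in N i & y in P] = setT) ->
    ~ (\bigcap_i N i `<=` P).

Definition coprimely_structured_module (R : comPzRingType) (M : lmodType R)
    : Prop :=
  forall P : set M, prime_submodule P -> coprimely_structured P.

Lemma maximal_submodule_prime (R : comPzRingType) (M : lmodType R) (P : set M) :
  maximal_submodule P -> prime_submodule P.
Proof.
case=> sP PT maxP; split=> // r m Prm.
have [P0 Plin] := sP.
pose N := [set x | P (r *: x)].
have sN : submodule N.
  split; first by apply/mem_set; rewrite /N /= scaler0; exact: set_mem P0.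
  move=> a u v /set_mem Nu /set_mem Nv; apply/mem_set; rewrite /N /=.
  rewrite scalerDr scalerA mulrC -scalerA.
  by apply: set_mem; apply: Plin; apply/mem_set.
have PN : P `<=` N.
  move=> x Px; rewrite /N /= -[_ *: x]addr0.
  by apply: set_mem; apply: Plin => //; apply/mem_set.
case: (maxP N sN PN) => NE; first by left; rewrite -NE.
by right=> x; change (N x); rewrite NE.
Qed.

(* Main.v *)
Require Import Defs.
From mathcomp Require Import all_boot all_algebra.
From mathcomp Require Import boolp classical_sets.

Set Implicit Arguments.
Unset Strict Implicit.
Unset Printing Implicit Defensive.

Import GRing.Theory.
Local Open Scope ring_scope.
Local Open Scope classical_set_scope.

(** A proper submodule [P] of a finitely generated module lies in a maximal
    submodule [Q]. If [N_i + P = M] for all [i] and the intersection of the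
    [N_i] is contained in [P], then the same two facts hold with [Q] in place
    of [P], so [Q] is not coprimely structured. *)

(** Removes the boolean [mem] wrapper once and for all, so that later arguments use plain
    propositional membership. *)
Lemma submoduleP (R : comPzRingType) (M : lmodType R) (N : set M) :
  submodule N <->
  N 0 /\ forall (a : R) (x y : M), N x -> N y -> N (a *: x + y).
Proof.
split=> [[N0 Nlin]|[N0 Nlin]].
  split=> [|a x y Nx Ny]; first exact: set_mem N0.
  by apply: set_mem; apply: Nlin; apply: mem_set.
split=> [|a x y /set_mem Nx /set_mem Ny]; first exact: mem_set.
by apply: mem_set; apply: Nlin.
Qed.

Lemma submodule_sum (R : comPzRingType) (M : lmodType R) (N : set M) (n : nat)
    (c : 'I_n -> R) (g : 'I_n -> M) :
  submodule N -> (forall i, N (g i)) -> N (\sum_(i < n) c i *: g i).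
Proof.
move=> /submoduleP[N0 Nlin] Ng.
by elim/big_rec: _ => // i x _ Nx; apply: Nlin.
Qed.

(** Induction on [n]: of the member holding the tail of the sequence and the one holding its head,
    the larger holds both. Nonemptiness of [F] settles [n = 0]. *)
Lemma chain_bigcup_seq (T : Type) (F : set (set T)) (n : nat) (g : 'I_n -> T) :
  F !=set0 -> total_on F subset ->
  (forall i, (\bigcup_(X in F) X) (g i)) ->
  exists2 X, F X & forall i, X (g i).
Proof.
move=> [X0 FX0] Ftot; elim: n g => [|n IHn] g Fg.
  by exists X0 => // -[].
have [X FX Xg] := IHn (fun i => g (lift ord0 i)) (fun i => Fg _).
have [Y FY Yg] := Fg ord0.
have [XY|YX] := Ftot X Y FX FY.
  exists Y => // i; case: (unliftP ord0 i) => [j ->|-> //].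
  exact/XY/Xg.
exists X => // i; case: (unliftP ord0 i) => [j -> //|->].
exact: YX.
Qed.

Lemma submodule_bigcup_chain (R : comPzRingType) (M : lmodType R)
    (F : set (set M)) :
  F !=set0 -> total_on F subset -> (forall X, F X -> submodule X) ->
  submodule (\bigcup_(X in F) X).
Proof.
move=> [X0 FX0] Ftot Fsub; apply/submoduleP; split.
  by exists X0 => //; have /submoduleP[] := Fsub _ FX0.
move=> a x y [X FX Xx] [Y FY Yy].
have [XY|YX] := Ftot X Y FX FY.
  exists Y => //; have /submoduleP[_ Ylin] := Fsub _ FY.
  exact: Ylin (XY _ Xx) Yy.
exists X => //; have /submoduleP[_ Xlin] := Fsub _ FX.
exact: Xlin Xx (YX _ Yy).
Qed.

(** This is where finite generation enters: if the union were all of [M], a single member of the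
    chain would contain every generator and so equal [M]. *)
Lemma proper_bigcup_chain (R : comPzRingType) (M : lmodType R)
    (F : set (set M)) :
  finitely_generated M -> F !=set0 -> total_on F subset ->
  (forall X, F X -> submodule X /\ X <> setT) ->
  \bigcup_(X in F) X <> setT.
Proof.
move=> [n [g Mg]] Fne Ftot FP UT.
have [|X FX Xg] := @chain_bigcup_seq _ F n g Fne Ftot; first by rewrite UT.
have [sX XT] := FP X FX; apply: XT; apply/seteqP; split=> // x _.
by have [c ->] := Mg x; apply: submodule_sum.
Qed.

Lemma maximal_submodule_exists (R : comPzRingType) (M : lmodType R)
    (P : set M) :
  finitely_generated M -> submodule P -> P <> setT ->
  exists2 Q, maximal_submodule Q & P `<=` Q.
Proof.
move=> Mfg sP PT.
(* Zorn_bigcup also covers the empty chain, whose union is empty: hence the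
   detour through [P `|` X] instead of the submodules containing [P]. *)
pose D (X : set M) := submodule (P `|` X) /\ P `|` X <> setT.
have [F FD Ftot|A [[sA AT] Amax]] := @Zorn_bigcup _ D.
  (* Adjoining [set0] to [F] puts [P] itself in [G], so [G] is a nonempty chain of proper submodules
     even when [F] is empty. *)
  pose G : set (set M) := [set P `|` X | X in set0 |` F].
  have UE : P `|` \bigcup_(X in F) X = \bigcup_(Y in G) Y.
    apply/seteqP; split=> x.
      case=> [Px|[X FX Xx]]; last by exists (P `|` X); [exists X; [right|]|right].
      by exists (P `|` set0); [exists set0; [left|]|left].
    case=> _ [X [->|FX] <-]; first by rewrite setU0; left.
    by case=> [Px|Xx]; [left|right; exists X].
  have Gne : G !=set0 by exists (P `|` set0); exists set0; [left|].
  have GP Y : G Y -> submodule Y /\ Y <> setT.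
    by case=> X [->|FX] <-; [rewrite setU0|exact: FD].
  have Gtot : total_on G subset.
    move=> _ _ [X FX <-] [Y FY <-].
    have [XY|YX] : X `<=` Y \/ Y `<=` X.
      case: FX FY => [->|FX] [->|FY];
        by [left; exact: sub0set|right; exact: sub0set|exact: Ftot].
    - by left; exact: setUS.
    - by right; exact: setUS.
  rewrite /D UE; split; last exact: proper_bigcup_chain.
  by apply: submodule_bigcup_chain => // Y /GP[].
exists (P `|` A); last exact: subsetUl.
split=> // N sN PAN; have [|NT] := pselect (N = setT); first by right.
left; apply/seteqP; split=> //.
have [PN AN] : P `<=` N /\ A `<=` N by rewrite -subUset.
have DN : D N by rewrite /D (iffRL (setUidPr _ _) PN).
(* Zorn gives maximality of [A], not of [P] united with [A]. It still applies to [N], which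
   satisfies [D] and contains [A] strictly: an inclusion of [N] in [A] would contradict [NA]. *)
apply: contrapT => NA; apply: (Amax N) => //; split=> // NsubA.
by apply: NA => x /NsubA; right.
Qed.

Theorem theorem3p1 (R : comPzRingType) (M : lmodType R)
    (Mfg : finitely_generated M)
    (Hmax : forall P : set M, maximal_submodule P -> coprimely_structured P) :
  coprimely_structured_module M.
Proof.
move=> P [sP PT _] I N sN NP capP.
have [Q maxQ PQ] := maximal_submodule_exists Mfg sP PT.
apply: (Hmax Q maxQ I N) => // [i|]; last exact: subset_trans PQ.
apply/seteqP; split=> // z _.
have [x Nx [y Py <-]] : [set x + y | x in N i & y in P] z by rewrite NP.
by exists x => //; exists y => //; exact: PQ.
Qed.
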